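(* Let $g:\mathbb{R}^n\to\mathbb{R}^m$, $h:\mathbb{R}^n\to\mathbb{R}^p$ be continuously differentiable, let $\kappa<n$ be an integer, and let $x^*$ be feasible for CCOP, i.e. $g(x^* )\le 0$, $h(x^* )=0$, $\|x^*\|_0\le\kappa$. Let $f:\mathbb{R}^n\to\mathbb{R}$ be the continuously differentiable objective function of CCOP. The following statements hold. (i) If $x^*$ is a CC-M-stationary point, then it is a CC-PAM-stationary point. (ii) If $x^*$ is a CC-PAM-stationary point and the CC-PAM-regularity condition holds at $x^*$, then $x^*$ is a CC-M-stationary point. (iii) If for every continuously differentiable objective function $f:\mathbb{R}^n\to\mathbb{R}$ the implication ''$x^*$ is CC-PAM-stationary $\Rightarrow$ $x^*$ is CC-M-stationary'' holds, then the CC-PAM-regularity condition holds at $x^*$.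
   Context: CCOP is the problem $\min f(x)$ s.t. $g(x)\le 0$, $h(x)=0$, $\|x\|_0\le\kappa$, where $\|x\|_0$ is the number of nonzero components of $x$. $\nabla g(x)\in\mathbb{R}^{n\times m}$ and $\nabla h(x)\in\mathbb{R}^{n\times p}$ have columns $\nabla g_i(x)$ and $\nabla h_j(x)$. Notation: $I_g(x)=\{i: g_i(x)=0\}$, $I_\pm(x)=\{\imath: x_\imath\ne 0\}$. CC-M-stationary: a feasible $x^*$ is CC-M-stationary (for objective $f$) if there exists $(\lambda,\mu,\gamma)\in\mathbb{R}^m_+\times\mathbb{R}^p\times\mathbb{R}^n$ with $\nabla f(x^* )+\nabla g(x^* )\lambda+\nabla h(x^* )\mu+\gamma=0$, $\lambda_i=0$ for all $i\notin I_g(x^* )$, and $\gamma_\imath=0$ for all $\imath\in I_\pm(x^* )$. CC-PAM-stationary: a feasible $x^*$ is CC-PAM-stationary (for objective $f$) if there is a sequence $\{(x^k,\lambda^k,\mu^k,\gamma^k)\}\subset\mathbb{R}^n\times\mathbb{R}^m_+\times\mathbb{R}^p\times\mathbb{R}^n$ such that, with $\pi_k=\|(1,\lambda^k,\mu^k,\gamma^k)\|_\infty$, for all sufficiently large $k$: (a) $x^k\to x^*$ and $\nabla f(x^k)+\nabla g(x^k)\lambda^k+\nabla h(x^k)\mu^k+\gamma^k\to 0$; (b) $\lambda_i^k=0$ for all $i\notin I_g(x^* )$, and $\gamma_\imath^k=0$ for all $\imath\in I_\pm(x^* )$; (c) $\lambda_i^k g_i(x^k)>0$ for every $i$ with $\lim_k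 \lambda_i^k/\pi_k>0$; (d) $\mu_j^k h_j(x^k)>0$ for every $j$ with $\lim_k|\mu_j^k|/\pi_k>0$; (e) $\gamma_\imath^k x_\imath^k>0$ for every $\imath$ with $\lim_k|\gamma_\imath^k|/\pi_k>0$. The bounded sequence $(\lambda^k,\mu^k,\gamma^k)/\pi_k$ is understood to converge (after passing to a subsequence), so that the limits in (c)-(e) exist. For $x\in\mathbb{R}^n$, $\alpha\ge0$, $\beta\ge0$, let $\Theta(x,\alpha,\beta)$ (which depends on the fixed $x^*$) be the set of all vectors $\nabla g(x)\lambda+\nabla h(x)\mu+\gamma$ with $(\lambda,\mu,\gamma)\in\mathbb{R}^m_+\times\mathbb{R}^p\times\mathbb{R}^n$ such that $\lambda_i=0$ for all $i\notin I_g(x^* )$; $\gamma_\imath=0$ for all $\imath\in I_\pm(x^* )$; and, with $\pi=\|(1,\lambda,\mu,\gamma)\|_\infty$: $\lambda_i g_i(x)\ge\alpha$ whenever $\lambda_i>\beta\pi$; $\mu_j h_j(x)\ge\alpha$ whenever $|\mu_j|>\beta\pi$; $\gamma_\imath x_\imath\ge\alpha$ whenever $|\gamma_\imath|>\beta\pi$. $\limsup_{x\to x^*,\,\alpha\downarrow0,\,\beta\downarrow0}\Theta(x,\alpha,\beta)$ is the set of all $z$ for which there exist $x^k\to x^*$, $\alpha_k\downarrow0$, $\beta_k\downarrow 0$ (with $\alpha_k,\beta_k>0$) and $z^k\in\Theta(x^k,\alpha_k,\beta_k)$ with $z^k\to z$. The CC-PAM-regularity condition holds at $x^*$ if $\limsup_{x\to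 x^*,\,\alpha\downarrow0,\,\beta\downarrow0}\Theta(x,\alpha,\beta)\subseteq\Theta(x^*,0,0)$. *)

(* Defs.v *)
From HB Require Import structures.
From mathcomp Require Import all_boot all_order all_algebra.
From mathcomp Require Import all_classical all_reals.
From mathcomp Require Import topology normedtype sequences derive.
Set Implicit Arguments.
Unset Strict Implicit.
Unset Printing Implicit Defensive.
Import Order.TTheory GRing.Theory Num.Theory.
Import numFieldNormedType.Exports.
Local Open Scope classical_set_scope.
Local Open Scope ring_scope.

(* Points and values of g, h are row vectors, because the library's [jacobian]
   is stated for maps between row vectors; ['J g x : 'M_(n, m)] then has the
   gradients of the components of g as its columns.  Gradients and
   multipliers are column vectors, so that [A *m lam] is the usual product. *)

Definition grad (R : realType) (n : nat) (f : 'rV[R]_n -> R) (x : 'rV[R]_n) :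
    'cV[R]_n :=
  \col_i 'D_(delta_mx 0 i) f x.

Definition C1_scalar (R : realType) (n : nat) (f : 'rV[R]_n -> R) : Prop :=
  (forall x, differentiable f x) /\ continuous (grad f).

Definition C1_map (R : realType) (n m : nat) (g : 'rV[R]_n -> 'rV[R]_m) :
    Prop :=
  (forall x, differentiable g x) /\ continuous (jacobian g).

Definition norm0 (R : realType) (n : nat) (x : 'rV[R]_n) : nat :=
  #|[set i | x 0 i != 0]%SET|.

Definition feasible (R : realType) (n m p : nat)
    (g : 'rV[R]_n -> 'rV[R]_m) (h : 'rV[R]_n -> 'rV[R]_p) (kappa : int)
    (x : 'rV[R]_n) : Prop :=
  [/\ forall i, g x 0 i <= 0, h x = 0 & (norm0 x)%:Z <= kappa].

Definition I_g (R : realType) (n m : nat) (g : 'rV[R]_n -> 'rV[R]_m)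
    (x : 'rV[R]_n) : {set 'I_m} :=
  [set i | g x 0 i == 0]%SET.

Definition I_pm (R : realType) (n : nat) (x : 'rV[R]_n) : {set 'I_n} :=
  [set i | x 0 i != 0]%SET.

Definition nonneg (R : realType) (m : nat) (lam : 'cV[R]_m) : Prop :=
  forall i, 0 <= lam i 0.

(* ||(1, lam, mu, gam)||_oo: the library norms on matrices and on products are
   both sup norms. *)
Definition pi_norm (R : realType) (m p n : nat)
    (lam : 'cV[R]_m) (mu : 'cV[R]_p) (gam : 'cV[R]_n) : R :=
  `|(1 : R, lam, mu, gam)|.

Definition multiplier_comb (R : realType) (n m p : nat)
    (g : 'rV[R]_n -> 'rV[R]_m) (h : 'rV[R]_n -> 'rV[R]_p) (x : 'rV[R]_n)
    (lam : 'cV[R]_m) (mu : 'cV[R]_p) (gam : 'cV[R]_n) : 'cV[R]_n :=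
  jacobian g x *m lam + jacobian h x *m mu + gam.

Definition multiplier_support (R : realType) (n m : nat)
    (g : 'rV[R]_n -> 'rV[R]_m) (xs : 'rV[R]_n)
    (lam : 'cV[R]_m) (gam : 'cV[R]_n) : Prop :=
  (forall i, i \notin I_g g xs -> lam i 0 = 0) /\
  (forall i, i \in I_pm xs -> gam i 0 = 0).

Definition CC_M_stationary (R : realType) (n m p : nat) (f : 'rV[R]_n -> R)
    (g : 'rV[R]_n -> 'rV[R]_m) (h : 'rV[R]_n -> 'rV[R]_p) (kappa : int)
    (xs : 'rV[R]_n) : Prop :=
  feasible g h kappa xs /\
  exists (lam : 'cV[R]_m) (mu : 'cV[R]_p) (gam : 'cV[R]_n),
    [/\ nonneg lam,
        grad f xs + multiplier_comb g h xs lam mu gam = 0 &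
        multiplier_support g xs lam gam].

(* The convergence of the normalized multipliers is part of the definition;
   without it the library's total operator [limn] would be meaningless in the
   last three clauses. *)
Definition CC_PAM_stationary (R : realType) (n m p : nat) (f : 'rV[R]_n -> R)
    (g : 'rV[R]_n -> 'rV[R]_m) (h : 'rV[R]_n -> 'rV[R]_p) (kappa : int)
    (xs : 'rV[R]_n) : Prop :=
  feasible g h kappa xs /\
  exists (x : nat -> 'rV[R]_n) (lam : nat -> 'cV[R]_m) (mu : nat -> 'cV[R]_p)
         (gam : nat -> 'cV[R]_n),
    let pi_ k := pi_norm (lam k) (mu k) (gam k) in
    (forall k, nonneg (lam k)) /\
    cvgn (fun k => (pi_ k)^-1 *: (lam k, mu k, gam k)) /\
    (x @ \oo --> xs) /\
    ((fun k => grad f (x k) + multiplier_comb g h (x k) (lam k) (mu k) (gam k))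
        @ \oo --> (0 : 'cV[R]_n)) /\
    (\forall k \near \oo,
      [/\ multiplier_support g xs (lam k) (gam k),
          forall i, 0 < limn (fun l => lam l i 0 / pi_ l) ->
            0 < lam k i 0 * g (x k) 0 i,
          forall j, 0 < limn (fun l => `|mu l j 0| / pi_ l) ->
            0 < mu k j 0 * h (x k) 0 j &
          forall i, 0 < limn (fun l => `|gam l i 0| / pi_ l) ->
            0 < gam k i 0 * x k 0 i]).

Definition Theta (R : realType) (n m p : nat)
    (g : 'rV[R]_n -> 'rV[R]_m) (h : 'rV[R]_n -> 'rV[R]_p) (xs : 'rV[R]_n)
    (x : 'rV[R]_n) (alpha beta : R) : set 'cV[R]_n :=
  [set z | exists (lam : 'cV[R]_m) (mu : 'cV[R]_p) (gam : 'cV[R]_n),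
    [/\ z = multiplier_comb g h x lam mu gam,
        nonneg lam,
        multiplier_support g xs lam gam &
        let pi := pi_norm lam mu gam in
        [/\ forall i, beta * pi < lam i 0 -> alpha <= lam i 0 * g x 0 i,
            forall j, beta * pi < `|mu j 0| -> alpha <= mu j 0 * h x 0 j &
            forall i, beta * pi < `|gam i 0| -> alpha <= gam i 0 * x 0 i]]].

(* [alpha] and [beta] decrease to 0 in the sense of one-sided limits: they are
   positive and converge to 0, monotonicity is not required. *)
Definition limsup_Theta (R : realType) (n m p : nat)
    (g : 'rV[R]_n -> 'rV[R]_m) (h : 'rV[R]_n -> 'rV[R]_p) (xs : 'rV[R]_n) :
    set 'cV[R]_n :=
  [set z | exists (x : nat -> 'rV[R]_n) (alpha beta : nat -> R)
                  (zs : nat -> 'cV[R]_n),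
    (x @ \oo --> xs) /\
    ((forall k, 0 < alpha k) /\ alpha @ \oo --> (0 : R)) /\
    ((forall k, 0 < beta k) /\ beta @ \oo --> (0 : R)) /\
    (forall k, Theta g h xs (x k) (alpha k) (beta k) (zs k)) /\
    (zs @ \oo --> z)].

Definition CC_PAM_regular (R : realType) (n m p : nat)
    (g : 'rV[R]_n -> 'rV[R]_m) (h : 'rV[R]_n -> 'rV[R]_p) (xs : 'rV[R]_n) :
    Prop :=
  limsup_Theta g h xs `<=` Theta g h xs xs 0 0.

(* Main.v *)
(* (i) A Caratheodory reduction makes the gradients carrying nonzero multipliers
   linearly independent, so some direction d increases each of the corresponding
   active constraints with the sign of its multiplier; the points xs + d / (k+1)
   with constant multipliers then give a CC-PAM sequence.
   (ii) A CC-PAM sequence lies in Theta for thresholds alpha, beta tending to 0,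
   so - grad f xs belongs to the upper limit of Theta.
   (iii) A point z of the upper limit of Theta makes xs CC-PAM-stationary for the
   linear objective x |-> - <z, x>, after passing to a subsequence along which
   the normalized multipliers converge. *)

Require Import Defs.
From HB Require Import structures.
From mathcomp Require Import all_boot all_order all_algebra.
From mathcomp Require Import all_classical all_reals.
From mathcomp Require Import topology normedtype sequences derive.
Import Order.TTheory GRing.Theory Num.Theory.
Import numFieldNormedType.Exports.
Local Open Scope classical_set_scope.
Local Open Scope ring_scope.
Set Implicit Arguments.
Unset Strict Implicit.
Unset Printing Implicit Defensive.

(** * Sign-preserving Caratheodory reduction *)

(** Once the columns carrying nonzero coefficients are independent, the products of a row vector [d]
    with them can be prescribed freely, in particular as the coefficients themselves. In the
    application the columns of [A] are constraint gradients, and along [d] each constraint with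
    nonzero multiplier moves, to first order, with the sign of that multiplier. *)
Lemma conformal_positive_combination (F : realFieldType) (n q : nat)
    (A : 'M[F]_(n, q)) (c : 'cV[F]_q) :
  exists (c' : 'cV[F]_q) (d : 'rV[F]_n),
    [/\ A *m c' = A *m c,
        forall i, 0 <= c i 0 -> 0 <= c' i 0,
        forall i, c i 0 = 0 -> c' i 0 = 0 &
        forall i, c' i 0 != 0 -> 0 < c' i 0 * (d *m A) 0 i].
Proof.
(* Induction on the support of c: a linear relation among the columns of A
   in the support removes one of them without changing any sign. *)
move: {2}#|_|.+1 (ltnSn #|[set i | c i 0 != 0]%SET|) => N.
elim: N c => [//|N IH] c; rewrite ltnS => cN.
have [[w [w0 Aw wc]]|indep] := pselect (exists w : 'cV[F]_q,
    [/\ w != 0, A *m w = 0 & forall i, c i 0 = 0 -> w i 0 = 0]).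
  have [i1 wi1] : exists i, w i 0 != 0.
    by have /matrix0Pn[i [j]] := w0; rewrite ord1 => ?; exists i.
  (* With the ratio of least absolute value as [t], the index [i0] leaves the support of
     [c - t *: w], and no entry changes sign because each [t * w i 0] is at most [c i 0] in absolute
     value. *)
  have [i0 wi0 i0min] : exists2 i0, w i0 0 != 0 &
      forall i, w i 0 != 0 -> `|c i0 0 / w i0 0| <= `|c i 0 / w i 0|.
    have [i wi imin] := @Order.TotalTheory.arg_minP _ _ _ i1
      (fun i => w i 0 != 0) (fun i => `|c i 0 / w i 0|) wi1.
    by exists i.
  pose t := c i0 0 / w i0 0.
  have tw i : `|t * w i 0| <= `|c i 0|.
    have [->|wi] := eqVneq (w i 0) 0; first by rewrite mulr0 normr0.
    rewrite normrM -ler_pdivlMr ?normr_gt0 // -normf_div; exact: i0min.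
  have /IH[c' [d [Ac' c'ge c'0 dpos]]] :
      (#|[set i : 'I_q | ((c - t *: w) i 0 != 0)%R]%SET| < N)%N.
    apply: leq_trans cN; apply/proper_card/properP; split.
      apply/fintype.subsetP => i; rewrite !inE; apply: contraNneq => ci.
      by rewrite !mxE ci (wc _ ci) mulr0 subr0.
    exists i0; rewrite !inE; first by apply: contraNneq wi0 => /wc ->.
    by rewrite !mxE divfK // subrr eqxx.
  exists c', d; split => //.
  - by rewrite Ac' mulmxBr -scalemxAr Aw scaler0 subr0.
  - move=> i ci; apply: c'ge; rewrite !mxE subr_ge0.
    by apply: le_trans (ler_norm _) _; apply: le_trans (tw i) _;
      rewrite ger0_norm.
  - by move=> i ci; apply: c'0; rewrite !mxE (wc _ ci) ci mulr0 subr0.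
(* [D] projects onto the support of [c], so [ker] below says that the columns of [A] indexed by this
   support are independent. *)
pose D : 'M[F]_q := diag_mx (\row_i (c i 0 != 0)%:R).
have DE m (M : 'M_(q, m)) i j : (D *m M) i j = (c i 0 != 0)%:R * M i j.
  by rewrite mul_diag_mx !mxE.
have ker (w : 'cV_q) : A *m (D *m w) = 0 -> D *m w = 0.
  move=> ADw; apply/eqP; apply/negPn/negP => Dw; apply: indep.
  by exists (D *m w); split => // i ci; rewrite DE ci eqxx mul0r.
(* Inclusion of kernels is dualized into inclusion of row spaces: [D = M *m (A *m D)], so [M]
   inverts [A] from the left on vectors supported where [c] is. *)
have /submxP[M DM] : (D <= A *m D)%MS.
  rewrite submxE; apply/eqP/matrixP => i j.
  have : A *m (D *m col j (cokermx (A *m D))) = 0.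
    rewrite mulmxA colE mulmxA.
    by rewrite mulmx_coker mul0mx.
  by move=> /ker/matrixP/(_ i 0); rewrite !DE !mxE => ->.
(* This [d] makes the entries of [d *m A] equal to those of [c] on the support, so the product to be
   shown positive is a square. *)
exists c, ((\row_i c i 0) *m M); split => // i ci.
have /matrixP/(_ 0 i) : (\row_i c i 0) *m M *m A *m D = (\row_i c i 0) *m D.
  by rewrite [in RHS]DM !mulmxA.
have uD (u : 'rV_q) : (u *m D) 0 i = u 0 i by rewrite mul_mx_diag !mxE ci mulr1.
rewrite !uD [in RHS]mxE => ->.
by rewrite -expr2 exprn_even_gt0.
Qed.

(** * Entrywise limits, common subsequences and vanishing thresholds *)

Section Convergence.
Variable R : realType.

Lemma cvg_mx (T : Type) (F : set_system T) (FF : Filter F) (m n : nat)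
    (M : T -> 'M[R]_(m, n)) (L : 'M[R]_(m, n)) :
  (forall i j, (M x i j) @[x --> F] --> L i j) -> M @ F --> L.
Proof.
move=> ML A [P LP sPA].
apply: (@filterS _ F _ (fun x => forall i j, P i j (M x i j))).
  by move=> x Px; exact: sPA.
apply: filter_forall => i; apply: filter_forall => j.
exact: (ML i j _ (LP i j)).
Qed.

Lemma cvg_coord (T : Type) (F : set_system T) (FF : Filter F) (m n : nat)
    (M : T -> 'M[R]_(m, n)) (L : 'M[R]_(m, n)) i j :
  M @ F --> L -> (M x i j) @[x --> F] --> L i j.
Proof.
by move=> ML; apply: (cvg_comp _ (fun N : 'M[R]_(m, n) => N i j) ML);
  exact: coord_continuous.
Qed.

Lemma cvg_mulmxl (T : Type) (F : set_system T) (FF : Filter F) (m n : nat)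
    (A : T -> 'M[R]_(m, n)) (L : 'M[R]_(m, n)) (v : 'cV[R]_n) :
  A @ F --> L -> (A x *m v) @[x --> F] --> L *m v.
Proof.
move=> AL; apply: cvg_mx => i j; rewrite mxE.
under eq_cvg do rewrite mxE.
apply: cvg_big => [|k _]; first exact: add_continuous.
by apply: cvgM; [exact: cvg_coord|exact: cvg_cst].
Qed.

Lemma mx_entry_le_norm (m n : nat) (M : 'M[R]_(m, n)) i j : `|M i j| <= `|M|.
Proof.
rewrite [leRHS]/Num.norm /= mx_normrE.
by apply/bigmax_geP; right; exists (i, j).
Qed.

Lemma cvg_increasing_seq (f : nat -> nat) : increasing_seq f -> f @ \oo --> \oo.
Proof.
move=> incf A [N _ NA]; exists N => // k /= Nk; apply: NA => /=.
apply: (leq_trans Nk); elim: k {Nk} => [//|k IH].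
by apply: (leq_ltn_trans IH); move/increasing_seqP: incf => /(_ k).
Qed.

(** Bolzano-Weierstrass is applied to one index at a time, along the subsequence already extracted;
    earlier limits survive because the new indices still tend to infinity. *)
Lemma common_cvg_subsequence (I : finType) (u : I -> nat -> R) (B : R) :
  (forall i k, `|u i k| <= B) ->
  exists2 f : nat -> nat, f @ \oo --> \oo & forall i, cvgn (u i \o f).
Proof.
move=> uB.
suff [f foo fP] : exists2 f : nat -> nat, f @ \oo --> \oo &
    forall i, i \in enum I -> cvgn (u i \o f).
  by exists f => // i; apply: fP; rewrite mem_enum.
elim: (enum I) => [|i s [f foo fP]]; first by exists id.
have [|e ince ecvg] := @bolzano_weierstrass R (u i \o f).
  exists B; split; first exact: num_real.
  by move=> x Bx k _; apply: le_trans (uB _ _) (ltW Bx).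
have eoo := cvg_increasing_seq ince.
exists (f \o e); first exact: cvg_comp eoo foo.
move=> j; rewrite inE => /orP[/eqP-> //|/fP /cvg_ex[l ul]].
by apply/cvg_ex; exists l; exact: (cvg_comp _ _ eoo ul).
Qed.

(** Turns the limit clauses of CC-PAM-stationarity into the threshold clauses of [Theta]: [a] is
    meant for normalized multipliers, [b] for products of a multiplier with its constraint. *)
Lemma vanishing_thresholds (I : finType) (a b : I -> nat -> R) (l : I -> R) :
  (forall i k, 0 <= a i k) -> (forall i, a i @ \oo --> l i) ->
  (\forall k \near \oo, forall i, 0 < l i -> 0 < b i k) ->
  exists alpha beta : nat -> R,
    [/\ (forall k, 0 < alpha k) /\ alpha @ \oo --> (0 : R),
        (forall k, 0 < beta k) /\ beta @ \oo --> (0 : R) &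
        \forall k \near \oo, forall i, beta k < a i k -> alpha k <= b i k].
Proof.
move=> a0 al bpos.
have l0 i : 0 <= l i.
  by rewrite -(cvg_lim _ (al i)) //; apply: limr_ge;
    [exact: cvgP (al i)|exact: nearW].
(* Replacing the nonpositive [b i k] keeps the minimum positive, and the initial value [harmonic k]
   forces it to 0. *)
pose alpha k := \big[Num.min/harmonic k]_i (if 0 < b i k then b i k else
  harmonic k).
(* Including every [a i] with limit 0 makes [beta k < a i k] impossible for such [i], so the test
   selects only indices with [0 < l i]; the harmonic term keeps [beta] positive. *)
pose beta k := harmonic k + \sum_(i | l i == 0) a i k.
have h0 k : 0 < harmonic k :> R by rewrite /harmonic /= invr_gt0.
have alpha0 k : 0 < alpha k.
  by rewrite /alpha; elim/big_ind: _ => // [x y x0 y0|i _];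
    [rewrite lt_min x0|case: ifP].
exists alpha, beta; split; first split => //.
- apply: (@squeeze_cvgr _ _ _ _ (cst 0) harmonic).
  + by apply: nearW => k /=; rewrite ltW //= /alpha; apply: bigmin_le_id.
  + exact: cvg_cst.
  + exact: cvg_harmonic.
- split=> [k|]; first by rewrite /beta ltr_wpDr // sumr_ge0.
  rewrite -[X in _ --> X]addr0; apply: cvgD; first exact: cvg_harmonic.
  rewrite -[X in _ --> X](@big1 _ _ +%R I (index_enum I) (fun i =>
    l i == 0) (fun=> 0)) //.
  apply: cvg_big => [|i /eqP <-]; [exact: add_continuous|exact: al].
- near=> k => i ak; have bk : forall i, 0 < l i -> 0 < b i k by near: k.
  have li : 0 < l i.
    rewrite lt_def l0 andbT; apply/eqP => li; move: ak; apply/negP;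
      rewrite -leNgt.
    rewrite /beta (bigD1 i) /=; last by rewrite li.
    rewrite addrCA lerDl.
    by apply: addr_ge0; [exact: ltW (h0 k)|exact: sumr_ge0].
  apply: le_trans (bigmin_le _ i _) _.
  by rewrite (bk _ li).
Unshelve. all: by end_near. Qed.

End Convergence.

(** * Stacking the three families of multipliers and constraints *)

Section Stacking.
Variables (R : realType) (n m p : nat).
Implicit Types (g : 'rV[R]_n -> 'rV[R]_m) (h : 'rV[R]_n -> 'rV[R]_p).
Implicit Types (x : 'rV[R]_n).
Implicit Types (lam : 'cV[R]_m) (mu : 'cV[R]_p) (gam : 'cV[R]_n).

Definition stack lam mu gam : 'cV[R]_(m + p + n) := col_mx (col_mx lam mu) gam.

(** The multipliers [gam] are paired with the coordinates of [x], which thus act as constraints;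
    their gradients form the identity block in [multiplier_combE]. *)
Definition constraints (g : 'rV[R]_n -> 'rV[R]_m) (h : 'rV[R]_n -> 'rV[R]_p)
    (x : 'rV[R]_n) : 'rV[R]_(m + p + n) :=
  row_mx (row_mx (g x) (h x)) x.

Lemma forall_stack (P : 'I_(m + p + n) -> Prop) :
  (forall i, P i) <->
  [/\ forall i, P (lshift n (lshift p i)),
      forall j, P (lshift n (rshift m j)) & forall i, P (rshift (m + p) i)].
Proof.
split=> [Pi|[P1 P2 P3] i]; first by split.
by case: (split_ordP i) => [i' ->|j -> //]; case: (split_ordP i') => j ->.
Qed.

Lemma stackE lam mu gam :
  (forall i, stack lam mu gam (lshift n (lshift p i)) 0 = lam i 0) *
  (forall j, stack lam mu gam (lshift n (rshift m j)) 0 = mu j 0) *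
  (forall i, stack lam mu gam (rshift (m + p) i) 0 = gam i 0).
Proof. by rewrite /stack; do !split=> *; rewrite ?(col_mxEu, col_mxEd). Qed.

Lemma constraintsE g h x :
  (forall i, constraints g h x 0 (lshift n (lshift p i)) = g x 0 i) *
  (forall j, constraints g h x 0 (lshift n (rshift m j)) = h x 0 j) *
  (forall i, constraints g h x 0 (rshift (m + p) i) = x 0 i).
Proof.
by rewrite /constraints; do !split=> *; rewrite ?(row_mxEl, row_mxEr).
Qed.

Lemma pi_norm_ge1 lam mu gam : 1 <= pi_norm lam mu gam.
Proof.
by rewrite /pi_norm /Num.norm /= !le_max normr1 lexx.
Qed.

Lemma pi_norm_gt0 lam mu gam : 0 < pi_norm lam mu gam.
Proof. exact: lt_le_trans ltr01 (pi_norm_ge1 _ _ _). Qed.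

(** Gives the compactness behind the subsequence in (iii): normalized multipliers are at most 1 in
    absolute value. *)
Lemma stack_le_pi_norm lam mu gam i :
  `|stack lam mu gam i 0| <= pi_norm lam mu gam.
Proof.
move: i; apply/forall_stack; split=> i; rewrite stackE.
- apply: le_trans (mx_entry_le_norm _ _ _) _.
  by rewrite [leRHS]/Num.norm /= !le_max lexx !orbT.
- apply: le_trans (mx_entry_le_norm _ _ _) _.
  by rewrite [leRHS]/Num.norm /= !le_max lexx !orbT.
- apply: le_trans (mx_entry_le_norm _ _ _) _.
  by rewrite [leRHS]/Num.norm /= !le_max lexx !orbT.
Qed.

Lemma multiplier_combE g h x lam mu gam :
  multiplier_comb g h x lam mu gam =
  row_mx (row_mx (jacobian g x) (jacobian h x)) 1%:M *m stack lam mu gam.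
Proof. by rewrite /stack !mul_row_col mul1mx. Qed.

(** Nonnegativity identifies [lam i 0] with its absolute value, which puts the first clause in the
    form of the other two. [P] and [Q] stand for the threshold tests of [Theta]. *)
Lemma sign_clauses_stack g h x lam mu gam (P Q : R -> Prop) :
  nonneg lam ->
  [/\ forall i, P (lam i 0) -> Q (lam i 0 * g x 0 i),
      forall j, P `|mu j 0| -> Q (mu j 0 * h x 0 j) &
      forall i, P `|gam i 0| -> Q (gam i 0 * x 0 i)] <->
  forall i, P `|stack lam mu gam i 0| ->
    Q (stack lam mu gam i 0 * constraints g h x 0 i).
Proof.
move=> lam0; split.
  move=> [P1 P2 P3]; apply/forall_stack; split=> i; rewrite stackE constraintsE.
  - by rewrite ger0_norm //; exact: P1.
  - exact: P2.
  - exact: P3.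
move=> /forall_stack[P1 P2 P3]; split=> i.
- by have := P1 i; rewrite stackE constraintsE ger0_norm.
- by have := P2 i; rewrite stackE constraintsE.
- by have := P3 i; rewrite stackE constraintsE.
Qed.

(** A version for limits: here the premises concern whole sequences and are not predicates of the
    multipliers at index [k] alone. *)
Lemma limit_sign_clauses_stack g h x (lam : nat -> 'cV[R]_m)
    (mu : nat -> 'cV[R]_p) (gam : nat -> 'cV[R]_n) (pi_ : nat -> R) k :
  (forall k, nonneg (lam k)) ->
  [/\ forall i, 0 < limn (fun l => lam l i 0 / pi_ l) ->
        0 < lam k i 0 * g x 0 i,
      forall j, 0 < limn (fun l => `|mu l j 0| / pi_ l) ->
        0 < mu k j 0 * h x 0 j &
      forall i, 0 < limn (fun l => `|gam l i 0| / pi_ l) ->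
        0 < gam k i 0 * x 0 i] <->
  forall i, 0 < limn (fun l => `|stack (lam l) (mu l) (gam l) i 0| / pi_ l) ->
    0 < stack (lam k) (mu k) (gam k) i 0 * constraints g h x 0 i.
Proof.
move=> lam0.
have E1 i : (fun l => `|stack (lam l) (mu l) (gam l) (lshift n (lshift p i)) 0|
    / pi_ l) = (fun l => lam l i 0 / pi_ l).
  by apply/funext => l; rewrite stackE ger0_norm //; exact: lam0.
have E2 j : (fun l => `|stack (lam l) (mu l) (gam l) (lshift n (rshift m j)) 0|
    / pi_ l) = (fun l => `|mu l j 0| / pi_ l).
  by apply/funext => l; rewrite stackE.
have E3 i : (fun l => `|stack (lam l) (mu l) (gam l) (rshift (m + p) i) 0|
    / pi_ l) = (fun l => `|gam l i 0| / pi_ l).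
  by apply/funext => l; rewrite stackE.
split.
  move=> [P1 P2 P3]; apply/forall_stack; split=> i; rewrite stackE constraintsE.
  - by rewrite E1; exact: P1.
  - by rewrite E2; exact: P2.
  - by rewrite E3; exact: P3.
move=> /forall_stack[P1 P2 P3]; split=> i.
- by have := P1 i; rewrite stackE constraintsE E1.
- by have := P2 i; rewrite stackE constraintsE E2.
- by have := P3 i; rewrite stackE constraintsE E3.
Qed.

(** Lets the convergence of normalized multipliers be checked and used one scalar at a time; [u]
    stands for the inverse of the norm. *)
Lemma is_cvg_triple (lam : nat -> 'cV[R]_m)
    (mu : nat -> 'cV[R]_p) (gam : nat -> 'cV[R]_n) (u : nat -> R) :
  cvgn (fun k => u k *: (lam k, mu k, gam k)) <->
  forall i, cvgn (fun k => u k * stack (lam k) (mu k) (gam k) i 0).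
Proof.
split.
  move=> /cvg_ex[/= [[L M] G] cv].
  have cv3 : (fun k => u k *: gam k) @ \oo --> G.
    by apply: (cvg_comp _ (snd : ('cV[R]_m * 'cV[R]_p) * 'cV[R]_n -> _) cv);
      exact: cvg_snd.
  have cv12 : (fun k => u k *: (lam k, mu k)) @ \oo --> (L, M).
    by apply: (cvg_comp _ (fst : ('cV[R]_m * 'cV[R]_p) * 'cV[R]_n -> _) cv);
      exact: cvg_fst.
  have cv2 : (fun k => u k *: mu k) @ \oo --> M.
    by apply: (cvg_comp _ (snd : 'cV[R]_m * 'cV[R]_p -> _) cv12);
      exact: cvg_snd.
  have cv1 : (fun k => u k *: lam k) @ \oo --> L.
    by apply: (cvg_comp _ (fst : 'cV[R]_m * 'cV[R]_p -> _) cv12);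
      exact: cvg_fst.
  apply/forall_stack; split=> i; apply/cvg_ex.
  - exists (L i 0); rewrite (_ : (fun k => _) = (fun k => (u k *: lam k) i 0)).
      exact: cvg_coord.
    by apply/funext => k; rewrite stackE mxE.
  - exists (M i 0); rewrite (_ : (fun k => _) = (fun k => (u k *: mu k) i 0)).
      exact: cvg_coord.
    by apply/funext => k; rewrite stackE mxE.
  - exists (G i 0); rewrite (_ : (fun k => _) = (fun k => (u k *: gam k) i 0)).
      exact: cvg_coord.
    by apply/funext => k; rewrite stackE mxE.
move=> /forall_stack[P1 P2 P3].
have cvg_scaled q (w : nat -> 'cV[R]_q) :
    (forall i, cvgn (fun k => u k * w k i 0)) ->
    (fun k => u k *: w k) @ \oo --> \col_i limn (fun k => u k * w k i 0).
  move=> cw; apply: cvg_mx => i j; rewrite !mxE ord1.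
  rewrite (_ : (fun k => _) = (fun k => u k * w k i 0)); first exact: cw.
  by apply/funext => k; rewrite mxE.
have cv1 : cvgn (fun k => u k *: lam k).
  by apply/cvg_ex; eexists; apply: cvg_scaled => i; have := P1 i;
    under eq_fun do rewrite stackE.
have cv2 : cvgn (fun k => u k *: mu k).
  by apply/cvg_ex; eexists; apply: cvg_scaled => i; have := P2 i;
    under eq_fun do rewrite stackE.
have cv3 : cvgn (fun k => u k *: gam k).
  by apply/cvg_ex; eexists; apply: cvg_scaled => i; have := P3 i;
    under eq_fun do rewrite stackE.
apply/cvg_ex; exists (limn (fun k => u k *: lam k),
  limn (fun k => u k *: mu k), limn (fun k => u k *: gam k)).
exact: (cvg_pair (G := nbhs (limn (fun k =>
  u k *: lam k), _)) (cvg_pair cv1 cv2) cv3).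
Qed.

End Stacking.

(** * Difference quotients and linear objectives *)

Lemma cvg_difference_quotient (R : realType) (n m : nat)
    (F : 'rV[R]_n -> 'rV[R]_m) (x d : 'rV[R]_n) :
  differentiable F x ->
  (harmonic k)^-1 *: (F (x + harmonic k *: d) - F x) @[k --> \oo]
    --> d *m jacobian F x.
Proof.
move=> dF; rewrite -deriveEjacobian //.
(* The derivative is a limit over punctured neighbourhoods of 0, which the harmonic sequence
   respects since it never vanishes. *)
have h0 : (harmonic : nat -> R) @ \oo --> 0^'.
  move=> A A0; have := @cvg_harmonic R _ A0.
  apply: (@filterS _ \oo _ _ (fun k => A (harmonic k))) => k; apply.
  by rewrite /harmonic /= invr_eq0 pnatr_eq0.
have dFd : derivable F x d by exact: diff_derivable.
have := cvg_comp _ _ h0 dFd.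
by under eq_cvg do rewrite /= (addrC (_ *: d)).
Qed.

Section LinearObjective.
Variables (R : realType) (n : nat) (v : 'cV[R]_n).

(** The test objective for (iii), taken there with [v] equal to [- z]. *)
Definition linear_objective (x : 'rV[R]_n) : R := (x *m v) 0 0.

Let linear_objective_linear : linear linear_objective.
Proof.
by move=> a x y; rewrite /linear_objective mulmxDl -scalemxAl !mxE.
Qed.

HB.instance Definition _ :=
  GRing.isLinear.Build R 'rV[R]_n R *%R linear_objective
    linear_objective_linear.

Let linear_objective_continuous : continuous linear_objective.
Proof.
have -> : linear_objective = fun x => \sum_k x 0 k * v k 0.
  by apply/funext => x; rewrite /linear_objective mxE.
apply: continuous_big => [|k _ x]; first exact: add_continuous.
by apply: continuousM; [exact: coord_continuous|exact: cst_continuous].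
Qed.

Lemma grad_linear_objective x : grad linear_objective x = v.
Proof.
apply/matrixP => i j; rewrite mxE ord1 deriveE; last first.
  exact: linear_differentiable.
rewrite diff_lin //= /linear_objective.
by rewrite -rowE mxE.
Qed.

Lemma C1_linear_objective : C1_scalar linear_objective.
Proof.
split=> [x|]; first exact: linear_differentiable.
by rewrite (_ : grad _ = cst v) ?funeqE //;
  [exact: cst_continuous|exact: grad_linear_objective].
Qed.

End LinearObjective.

(** * The three implications *)

Section Stationarity.
Variables (R : realType) (n m p : nat).
Variables (g : 'rV[R]_n -> 'rV[R]_m) (h : 'rV[R]_n -> 'rV[R]_p).
Hypotheses (hg : C1_map g) (hh : C1_map h).
Implicit Types (xs : 'rV[R]_n) (f : 'rV[R]_n -> R).

Lemma cvg_multiplier_comb (x : nat -> 'rV[R]_n) xs lam mu gam :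
  x @ \oo --> xs ->
  multiplier_comb g h (x k) lam mu gam @[k --> \oo]
    --> multiplier_comb g h xs lam mu gam.
Proof.
move=> xxs; apply: cvgD; last exact: cvg_cst.
by apply: cvgD; apply: cvg_mulmxl; apply: cvg_comp xxs _;
  [exact: hg.2|exact: hh.2].
Qed.

(** At [xs] the support conditions and [h xs = 0] make every product of a multiplier with its
    constraint vanish, so with threshold 0 the sign clauses reduce to [0 <= 0]. *)
Lemma Theta_base xs z lam mu gam :
  h xs = 0 -> z = multiplier_comb g h xs lam mu gam -> nonneg lam ->
  multiplier_support g xs lam gam -> Theta g h xs xs 0 0 z.
Proof.
move=> hxs -> lam0 [lamI gamI]; exists lam, mu, gam; split => //.
split=> i _.
- have [/[!inE]/eqP ->|/lamI ->] := boolP (i \in I_g g xs);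
    by rewrite ?mulr0 ?mul0r.
- by rewrite hxs mxE mulr0.
- have [/gamI ->|/[!inE]/negPn/eqP ->] := boolP (i \in I_pm xs);
    by rewrite ?mulr0 ?mul0r.
Qed.

(** Allows the difference quotient of such a constraint at [xs] to be read as its value divided by
    the step length. *)
Lemma constraints_active xs lam mu gam i :
  h xs = 0 -> multiplier_support g xs lam gam ->
  stack lam mu gam i 0 != 0 -> constraints g h xs 0 i = 0.
Proof.
move=> hxs [lamI gamI]; move: i; apply/forall_stack.
split=> i; rewrite stackE constraintsE.
- by have [/[!inE]/eqP ->|/lamI ->] := boolP (i \in I_g g xs); rewrite ?eqxx.
- by rewrite hxs mxE.
- by have [/gamI ->|/[!inE]/negPn/eqP ->] := boolP (i \in I_pm xs);
    rewrite ?eqxx.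
Qed.

Lemma cvg_constraints_quotient (xs d : 'rV[R]_n) i :
  (harmonic k)^-1 * (constraints g h (xs + harmonic k *: d) 0 i
     - constraints g h xs 0 i) @[k --> \oo] -->
  (d *m row_mx (row_mx (jacobian g xs) (jacobian h xs)) 1%:M) 0 i.
Proof.
have entry q (F : 'rV[R]_n -> 'rV[R]_q) j : differentiable F xs ->
    (harmonic k)^-1 * (F (xs + harmonic k *: d) 0 j - F xs 0 j) @[k --> \oo]
      --> (d *m jacobian F xs) 0 j.
  move=> /(cvg_difference_quotient (d := d)) dF.
  rewrite (_ : (fun k => _) = (fun k =>
    ((harmonic k)^-1 *: (F (xs + harmonic k *: d) - F xs)) 0 j)).
    exact: cvg_coord.
  by apply/funext => k; rewrite !mxE.
rewrite !mul_mx_row mulmx1; move: i; apply/forall_stack; split=> i.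
- rewrite !row_mxEl; under eq_cvg do rewrite !constraintsE.
  by apply: entry; exact: hg.1.
- rewrite row_mxEl row_mxEr; under eq_cvg do rewrite !constraintsE.
  by apply: entry; exact: hh.1.
(* On the coordinate block the quotient is constant, the step length being nonzero. *)
- rewrite row_mxEr (_ : (fun k => _) = cst (d 0 i)); first exact: cvg_cst.
  apply/funext => k; rewrite !constraintsE !mxE addrAC subrr add0r mulKf //.
  by rewrite invr_eq0 pnatr_eq0.
Qed.

Lemma CC_M_stationary_PAM kappa xs f :
  C1_scalar f -> CC_M_stationary f g h kappa xs ->
  CC_PAM_stationary f g h kappa xs.
Proof.
move=> hf [fxs [lam0 [mu0 [gam0 [lam0_ge0 stat [lamI gamI]]]]]]; split => //.
have [_ hxs _] := fxs.
have [c [d [Ac c_ge0 c_eq0 dpos]]] := conformal_positive_combination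
  (row_mx (row_mx (jacobian g xs) (jacobian h xs)) 1%:M) (stack lam0 mu0 gam0).
pose lam : 'cV_m := usubmx (usubmx c).
pose mu : 'cV_p := dsubmx (usubmx c).
pose gam : 'cV_n := dsubmx c.
have cE : c = stack lam mu gam by rewrite /stack !vsubmxK.
have lam_ge0 : nonneg lam.
  by move=> i; have := c_ge0 (lshift n (lshift p i)); rewrite cE !stackE; apply.
have supp : multiplier_support g xs lam gam.
  split=> i iI.
    by have := c_eq0 (lshift n (lshift p i)); rewrite cE !stackE; apply;
      exact: lamI.
  by have := c_eq0 (rshift (m + p) i); rewrite cE !stackE; apply; exact: gamI.
pose x k := xs + harmonic k *: d.
have xxs : x @ \oo --> xs.
  rewrite -[X in _ --> X]addr0; apply: cvgD; first exact: cvg_cst.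
  rewrite -[X in _ --> X](scale0r d); apply: cvgZ;
    [exact: cvg_harmonic|exact: cvg_cst].
exists x, (fun=> lam), (fun=> mu), (fun=> gam) => /=; split => //.
split; first by apply/is_cvg_triple => i; exact: is_cvg_cst.
split => //; split.
  have <- : grad f xs + multiplier_comb g h xs lam mu gam = 0.
    by rewrite multiplier_combE -cE Ac -multiplier_combE.
  apply: cvgD; last exact: cvg_multiplier_comb.
  by apply: cvg_comp xxs _; exact: hf.2.
have signs : \forall k \near \oo, forall i, c i 0 != 0 ->
    0 < c i 0 * constraints g h (x k) 0 i.
  apply: filter_forall => i.
  have [->|ci] := eqVneq (c i 0) 0; first exact: nearW.
  have cvq : c i 0 * ((harmonic k)^-1 * (constraints g h (x k) 0 i
        - constraints g h xs 0 i)) @[k --> \oo] -->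
      c i 0 * (d *m row_mx (row_mx (jacobian g xs) (jacobian h xs)) 1%:M) 0 i.
    by apply: cvgM; [exact: cvg_cst|exact: cvg_constraints_quotient].
  apply: filterS (cvgr_gt _ cvq _ (dpos _ ci)) => k /= + _.
  rewrite (constraints_active (mu :=
    mu) hxs supp) -?cE // subr0 mulrCA pmulr_rgt0 //.
  by rewrite invr_gt0 /harmonic /= invr_gt0.
near=> k.
have sk : forall i, c i 0 != 0 -> 0 < c i 0 * constraints g h (x k) 0 i by
  near: k.
(* For constant multipliers the limit is that of a constant sequence, hence positive only if [c i 0]
   is nonzero. *)
have sk' i : 0 < limn (fun=> `|stack lam mu gam i 0| / pi_norm lam mu gam) ->
    0 < stack lam mu gam i 0 * constraints g h (x k) 0 i.
  rewrite -cE => lim0; apply: sk; apply: contraTneq lim0 => ci.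
  by rewrite -leNgt ci normr0 mul0r lim_cst.
have [s1 s2 s3] := (@limit_sign_clauses_stack _ _ _ _ g h (x k) (fun=> lam)
  (fun=> mu) (fun=> gam) (fun=> pi_norm lam mu gam) k (fun=> lam_ge0)).2 sk'.
by split.
Unshelve. all: by end_near. Qed.

Lemma CC_PAM_regular_stationary_M kappa xs f :
  C1_scalar f -> CC_PAM_stationary f g h kappa xs -> CC_PAM_regular g h xs ->
  CC_M_stationary f g h kappa xs.
Proof.
move=> hf [fxs [x [lam [mu [gam /= [lam_ge0 [cvm [xxs [stat ev]]]]]]]]] reg.
split => //.
pose pi_ k := pi_norm (lam k) (mu k) (gam k).
have pi_gt0 k : 0 < pi_ k by exact: pi_norm_gt0.
pose c k := stack (lam k) (mu k) (gam k).
pose a i k := `|c k i 0| / pi_ k.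
have ca i : cvgn (a i).
  rewrite (_ : a i = fun k => `|(pi_ k)^-1 * c k i 0|); last first.
    by apply/funext => k; rewrite normrM gtr0_norm ?invr_gt0 // mulrC.
  by apply: is_cvg_norm; move: i; apply/is_cvg_triple.
have [alpha [beta [[alpha0 alphato0] [beta0 betato0] thr]]] :
    exists alpha beta : nat -> R,
    [/\ (forall k, 0 < alpha k) /\ alpha @ \oo --> (0 : R),
        (forall k, 0 < beta k) /\ beta @ \oo --> (0 : R) &
        \forall k \near \oo, forall i, beta k < a i k ->
          alpha k <= c k i 0 * constraints g h (x k) 0 i].
  apply: (@vanishing_thresholds _ _ a _ (fun i => limn (a i))) => //.
    by move=> i k; rewrite divr_ge0 // ltW.
  by apply: filterS ev => k [_ s1 s2 s3]; apply/limit_sign_clauses_stack.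
(* The conditions hold only from some [N] on, whereas the upper limit asks for membership in [Theta]
   at every index; all sequences are therefore shifted by [N] below. *)
have [N _ NP] : \forall k \near \oo,
    multiplier_support g xs (lam k) (gam k) /\
    forall i, beta k < a i k -> alpha k <= c k i 0 * constraints g h (x k) 0 i.
  by near=> k; split; near: k => //; apply: filterS ev => k [].
pose zs k := multiplier_comb g h (x k) (lam k) (mu k) (gam k).
(* [zs k] is the stationarity residual, which tends to 0, minus [grad f (x k)], which converges by
   continuity. *)
have zsto : zs @ \oo --> - grad f xs.
  rewrite -[X in _ --> X]add0r (_ : zs = fun k =>
    grad f (x k) + zs k - grad f (x k)).
    by apply: cvgB => //; apply: cvg_comp xxs _; exact: hf.2.
  by apply/funext => k; rewrite addrAC subrr add0r.
have shift (T : topologicalType) (u : nat -> T) (l : T) :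
    u @ \oo --> l -> (fun k => u (k + N)%N) @ \oo --> l.
  by move=> ul; apply: cvg_comp ul; exact: cvg_addnr.
have [l [u [w [zE l0 supp _]]]] : Theta g h xs xs 0 0 (- grad f xs).
  apply: reg; exists (fun k => x (k + N)%N), (fun k => alpha (k + N)%N),
    (fun k => beta (k + N)%N), (fun k => zs (k + N)%N).
  split; first exact: shift.
  split; first by split => //; exact: shift.
  split; first by split => //; exact: shift.
  split; last exact: shift.
  move=> k; exists (lam (k + N)%N), (mu (k + N)%N), (gam (k + N)%N).
  have [supp sgn] := NP (k + N)%N (leq_addl _ _).
  split => //; apply/(@sign_clauses_stack _ _ _ _ g h _ _ _ _
    (fun s => beta (k + N)%N * pi_ (k + N)%N < s)
    (fun s => alpha (k + N)%N <= s)) => //.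
  by move=> i ai; apply: sgn; rewrite ltr_pdivlMr //.
exists l, u, w; split => //.
by rewrite -zE subrr.
Unshelve. all: by end_near. Qed.

Lemma stationarity_transfer_CC_PAM_regular kappa xs :
  feasible g h kappa xs ->
  (forall f, C1_scalar f ->
     CC_PAM_stationary f g h kappa xs -> CC_M_stationary f g h kappa xs) ->
  CC_PAM_regular g h xs.
Proof.
move=> fxs transfer z [x [alpha [beta [zs [xxs [[alpha0 _]
  [[_ betato0] [zsT zsz]]]]]]]].
have /choice[t tP] : forall k, exists t : 'cV[R]_m * 'cV[R]_p * 'cV[R]_n,
    [/\ zs k = multiplier_comb g h (x k) t.1.1 t.1.2 t.2, nonneg t.1.1,
        multiplier_support g xs t.1.1 t.2 &
        forall i, beta k * pi_norm t.1.1 t.1.2 t.2 <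
            `|stack t.1.1 t.1.2 t.2 i 0| ->
          alpha k <= stack t.1.1 t.1.2 t.2 i 0 * constraints g h (x k) 0 i].
  move=> k; have [l [u [w [zE l0 supp sgn]]]] := zsT k.
  exists (l, u, w); split => //=.
  exact: (@sign_clauses_stack _ _ _ _ g h _ _ _ _
    (fun s => beta k * pi_norm l u w < s) (fun s => alpha k <= s) l0).1 sgn.
pose c k := stack (t k).1.1 (t k).1.2 (t k).2.
pose pi_ k := pi_norm (t k).1.1 (t k).1.2 (t k).2.
have pi_gt0 k : 0 < pi_ k by exact: pi_norm_gt0.
have [e eoo ecvg] : exists2 e : nat -> nat, e @ \oo --> \oo &
    forall i, cvgn ((fun k => (pi_ k)^-1 * c k i 0) \o e).
  apply: (@common_cvg_subsequence R _ (fun i k => (pi_ k)^-1 * c k i 0) 1) =>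
    i k.
  rewrite normrM gtr0_norm ?invr_gt0 // mulrC ler_pdivrMr // mul1r.
  exact: stack_le_pi_norm.
have sub (T : topologicalType) (u : nat -> T) (l : T) :
    u @ \oo --> l -> (u \o e) @ \oo --> l.
  by move=> ul; apply: cvg_comp ul.
pose f := linear_objective (- z).
have [_ [l [u [w [l0 stat supp]]]]] : CC_M_stationary f g h kappa xs.
  apply: transfer; first exact: C1_linear_objective.
  split => //.
  exists (x \o e), (fun k => (t (e k)).1.1), (fun k => (t (e k)).1.2),
    (fun k => (t (e k)).2) => /=.
  have t_ge0 k : nonneg (t (e k)).1.1 by have [] := tP (e k).
  split => //; split; first exact/is_cvg_triple.
  split; first exact: sub.
  split.
    rewrite (_ : (fun k => _) = (fun k => - z + zs (e k))); last first.
      by apply/funext => k; rewrite grad_linear_objective;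
        have [<-] := tP (e k).
    rewrite -(addNr z); apply: cvgD; [exact: cvg_cst|exact: sub].
  have signs : \forall k \near \oo, forall i,
      0 < limn (fun l => `|c (e l) i 0| / pi_ (e l)) ->
      0 < c (e k) i 0 * constraints g h (x (e k)) 0 i.
    apply: filter_forall => i; set L := limn _.
    have [L0|L0] := ltP 0 L; last by apply: nearW => k.
    have cvL : (fun l => `|c (e l) i 0| / pi_ (e l)) @ \oo --> L.
      rewrite /L (_ : (fun l => _) = fun l => `|(pi_ (e l))^-1 * c (e l) i 0|).
        exact: is_cvg_norm (ecvg i).
      by apply/funext => k; rewrite normrM gtr0_norm ?invr_gt0 // mulrC.
    (* Since [beta] tends to 0, a normalized multiplier with positive limit eventually exceeds it;
       membership in [Theta] then bounds the product below by the positive [alpha]. *)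
    have cvLb : `|c (e l) i 0| / pi_ (e l) - beta (e l) @[l --> \oo] --> L.
      by rewrite -[L]subr0; apply: cvgB => //; exact: sub.
    apply: filterS (cvgr_gt _ cvLb _ L0) => k /=;
      rewrite subr_gt0 ltr_pdivlMr // => lt_c _.
    have [_ _ _ /(_ i lt_c)] := tP (e k); exact: lt_le_trans.
  near=> k; have [_ _ supp _] := tP (e k).
  have sk : forall i, 0 < limn (fun l => `|c (e l) i 0| / pi_ (e l)) ->
      0 < c (e k) i 0 * constraints g h (x (e k)) 0 i by near: k.
  have [s1 s2 s3] := (@limit_sign_clauses_stack _ _ _ _ g h (x (e k))
    (fun k => (t (e k)).1.1) (fun k => (t (e k)).1.2) (fun k => (t (e k)).2)
    (pi_ \o e) k t_ge0).2 sk.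
  by split.
have [_ hxs _] := fxs.
(* The multipliers supplied by CC-M-stationarity represent [z] itself, because the objective has
   gradient [- z]. *)
apply: Theta_base hxs _ l0 supp.
move: stat; rewrite grad_linear_objective addrC => /eqP.
by rewrite subr_eq0 => /eqP <-.
Unshelve. all: by end_near. Qed.

End Stationarity.

Theorem theorem4p1 (R : realType) (n m p : nat)
    (g : 'rV[R]_n -> 'rV[R]_m) (h : 'rV[R]_n -> 'rV[R]_p)
    (hg : C1_map g) (hh : C1_map h)
    (kappa : int) (hkappa : kappa < n%:Z)
    (xs : 'rV[R]_n) (hxs : feasible g h kappa xs)
    (f : 'rV[R]_n -> R) (hf : C1_scalar f) :
  (CC_M_stationary f g h kappa xs -> CC_PAM_stationary f g h kappa xs) /\
  (CC_PAM_stationary f g h kappa xs -> CC_PAM_regular g h xs ->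
     CC_M_stationary f g h kappa xs) /\
  ((forall f' : 'rV[R]_n -> R, C1_scalar f' ->
      CC_PAM_stationary f' g h kappa xs -> CC_M_stationary f' g h kappa xs) ->
   CC_PAM_regular g h xs).
Proof.
split; first exact: CC_M_stationary_PAM.
split; first exact: CC_PAM_regular_stationary_M.
exact: stationarity_transfer_CC_PAM_regular.
Qed.
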